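(* Let $\overline{A_1A_2A_3}$ be a triangle in the plane over a field not of characteristic two, with red orthocenter $O_r$, red circumcenter $C_r$, red nine-point center $N_r$, and centroid $G$. Then the points $O_r,N_r,G$ and $C_r$ lie on a line, called the red Euler line. Furthermore $N_r$ is the midpoint of $O_r$ and $C_r$, and $$G=\tfrac13 O_r+\tfrac23 C_r=\tfrac13 C_r+\tfrac23 N_r.$$
   Context: A point is an ordered pair $[x,y]$ of field elements. A line is a proportion $\langle a:b:c\rangle$ with $a,b$ not both zero; the point $[x,y]$ lies on it precisely when $ax+by+c=0$. Lines $\langle a_1:b_1:c_1\rangle$ and $\langle a_2:b_2:c_2\rangle$ are red perpendicular when $a_1a_2-b_1b_2=0$. A triangle $\overline{A_1A_2A_3}$ is a set of three distinct non-collinear points. The red altitude from a point $A$ to a line $l$ is the unique line through $A$ red perpendicular to $l$. The red orthocenter of a triangle is the common point of the three red altitudes from its points to the opposite lines. The red perpendicular bisector of a side $\overline{A_iA_j}$ is the red altitude from the midpoint of $A_i$ and $A_j$ to the line $A_iA_j$; the red circumcenter is the common point of the three red perpendicular bisectors. (These common points always exist and are unique.) The red nine-point center of $\overline{A_1A_2A_3}$ is the red circumcenter of the triangle of midpoints of its sides. The centroid $G$ is the intersection of the medians (the lines joining each point of the triangle to the midpoint of the opposite side). Affine combinations of points are taken coordinatewise. *)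

(* Defs.v *)
From mathcomp Require Import all_boot all_algebra.

Set Implicit Arguments.
Unset Strict Implicit.
Unset Printing Implicit Defensive.

Import GRing.Theory.
Local Open Scope ring_scope.

(* F^o gives pairs their coordinatewise module structure, so that
   a *: A + b *: B is the coordinatewise affine combination. *)
Notation point F := (F^o * F^o)%type.

(* A representative (a, b, c) of the proportion <a : b : c>; every predicate
   below is invariant under rescaling it by a nonzero scalar. *)
Record line (F : fieldType) := Line {
  la : F;
  lb : F;
  lc : F;
  line_neq0 : (la != 0) || (lb != 0)
}.

Section RedGeometry.

Variable F : fieldType.
Implicit Types (A B C P : point F) (l m : line F).

Definition on_line P l : Prop := la l * P.1 + lb l * P.2 + lc l = 0.

Definition red_perpendicular l m : Prop := la l * la m - lb l * lb m = 0.

Definition line_through A B l : Prop := on_line A l /\ on_line B l.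

Definition triangle A B C : Prop :=
  [/\ A <> B, B <> C, C <> A &
      ~ exists l, [/\ on_line A l, on_line B l & on_line C l]].

Definition midpoint A B : point F := (1 / 2) *: A + (1 / 2) *: B.

Definition red_altitude A l m : Prop := on_line A m /\ red_perpendicular m l.

Definition on_red_altitude A B C P : Prop :=
  exists l m, [/\ line_through B C l, red_altitude A l m & on_line P m].

Definition red_orthocenter A B C P : Prop :=
  [/\ on_red_altitude A B C P, on_red_altitude B C A P
    & on_red_altitude C A B P].

Definition on_red_perp_bisector A B P : Prop :=
  on_red_altitude (midpoint A B) A B P.

Definition red_circumcenter A B C P : Prop :=
  [/\ on_red_perp_bisector A B P, on_red_perp_bisector B C P
    & on_red_perp_bisector C A P].

Definition red_nine_point_center A B C P : Prop :=
  red_circumcenter (midpoint B C) (midpoint C A) (midpoint A B) P.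

Definition on_median A B C P : Prop :=
  exists l, line_through A (midpoint B C) l /\ on_line P l.

(* In characteristic three the medians are distinct parallels, so that no
   point satisfies this predicate. *)
Definition centroid A B C P : Prop :=
  [/\ on_median A B C P, on_median B C A P & on_median C A B P].

End RedGeometry.

(* Main.v *)
(** In the red form [u.v = u1 v1 - u2 v2], the altitude condition on [O] reads
    [(C - B).(O - A) = 0], and the bisector condition on [K] reads
    [(C - B).(2 K - B - C) = 0].  Hence [O + 2 K - (A + B + C)] is
    orthogonal to every side; two sides are independent and the form is
    nondegenerate, so [O + 2 K = A + B + C = 3 G].  The sides of the medial
    triangle are parallel to those of [ABC], and the same argument gives
    [2 N = O + K]. *)
Require Import Defs.
From mathcomp Require Import all_boot all_algebra.
From mathcomp Require Import ring.

Set Implicit Arguments.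
Unset Strict Implicit.
Unset Printing Implicit Defensive.

Import GRing.Theory.
Local Open Scope ring_scope.

Definition red_dot (F : fieldType) (u v : point F) : F :=
  u.1 * v.1 - u.2 * v.2.

Definition cross (F : fieldType) (u v : point F) : F :=
  u.1 * v.2 - u.2 * v.1.

(** Two vectors annihilated by the same nonzero [(x, y)] are proportional. Multiplying the
    determinant by the nonzero coordinate exhibits it as a combination of the two equations. *)
Lemma det2_eq0 (F : fieldType) (x y a b c d : F) :
  (x != 0) || (y != 0) -> x * a + y * b = 0 -> x * c + y * d = 0 ->
  a * d - b * c = 0.
Proof.
move=> xy0 e1 e2; case/orP: xy0 => z0; apply: (mulfI z0); rewrite mulr0.
  have -> : x * (a * d - b * c) = (x * a + y * b) * d - (x * c + y * d) * b
    by ring.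
  by rewrite e1 e2; ring.
have -> : y * (a * d - b * c) = (x * c + y * d) * a - (x * a + y * b) * c
  by ring.
by rewrite e1 e2; ring.
Qed.

Lemma on_line_sub (F : fieldType) (P Q : point F) (l : line F) :
  on_line P l -> on_line Q l ->
  la l * (Q.1 - P.1) + lb l * (Q.2 - P.2) = 0.
Proof.
rewrite /on_line => hP hQ.
have -> : la l * (Q.1 - P.1) + lb l * (Q.2 - P.2) =
  (la l * Q.1 + lb l * Q.2 + lc l) - (la l * P.1 + lb l * P.2 + lc l) by ring.
by rewrite hP hQ subrr.
Qed.

Lemma collinear_cross (F : fieldType) (P Q R : point F) (l : line F) :
  on_line P l -> on_line Q l -> on_line R l -> cross (Q - P) (R - P) = 0.
Proof.
move=> hP hQ hR.
exact: (det2_eq0 (line_neq0 l) (on_line_sub hP hQ) (on_line_sub hP hR)).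
Qed.

Lemma cross_collinear (F : fieldType) (P Q : point F) : P <> Q ->
  exists2 l : line F, line_through P Q l
    & forall R, cross (Q - P) (R - P) = 0 -> on_line R l.
Proof.
move=> PQ.
have n0 : (P.2 - Q.2 != 0) || (Q.1 - P.1 != 0).
  rewrite -negb_and; apply/negP=> /andP[/eqP e2 /eqP e1]; apply: PQ.
  case: P Q e1 e2 => [p1 p2] [q1 q2] /= /subr0_eq -> /subr0_eq ->.
  by [].
(* With these coefficients, the left side of the line's equation at [R] is exactly
   [cross (Q - P) (R - P)]. *)
exists (@Line F _ _ (- ((P.2 - Q.2) * P.1 + (Q.1 - P.1) * P.2)) n0).
  by split; rewrite /on_line /=; ring.
by move=> R c0; rewrite /on_line /= -c0 /cross /=; ring.
Qed.

Lemma triangle_cross (F : fieldType) (A B C : point F) :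
  triangle A B C -> cross (B - A) (C - A) != 0.
Proof.
move=> [AB _ _ nl]; apply/eqP=> c0; apply: nl.
have [l [lA lB] lR] := cross_collinear AB.
by exists l; split=> //; apply: lR.
Qed.

(** Both [C - B] and [(la m, - lb m)] are annihilated by the normal of [l], hence parallel. So
    [C - B] with its coordinates swapped is a direction of [m], as is [P - A]. *)
Lemma on_red_altitude_dot (F : fieldType) (A B C P : point F) :
  on_red_altitude A B C P -> red_dot (C - B) (P - A) = 0.
Proof.
move=> [l [m [[lB lC] [mA ml] mP]]].
have ml' : la l * la m + lb l * - lb m = 0 by rewrite -ml; ring.
have dm := det2_eq0 (line_neq0 l) (on_line_sub lB lC) ml'.
have dm' : la m * (C.2 - B.2) + lb m * (C.1 - B.1) = 0.
  by rewrite -[RHS]oppr0 -dm; ring.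
have e := det2_eq0 (line_neq0 m) dm' (on_line_sub mA mP).
by rewrite -[RHS]oppr0 -e /red_dot /=; ring.
Qed.

Lemma on_median_cross (F : fieldType) (A B C P : point F) :
  on_median A B C P -> cross (midpoint B C - A) (P - A) = 0.
Proof. by move=> [l [[lA lM] lP]]; apply: collinear_cross lA lM lP. Qed.

(** Cramer's rule for two linear equations in [w], whose determinant is [cross u v] up to sign. *)
Lemma red_dot_nondegenerate (F : fieldType) (u v w : point F) :
  cross u v != 0 -> red_dot u w = 0 -> red_dot v w = 0 -> w = 0.
Proof.
move=> c0 hu hv.
have e1 : cross u v * w.1 = red_dot u w * v.2 - red_dot v w * u.2.
  by rewrite /cross /red_dot; ring.
have e2 : cross u v * w.2 = red_dot u w * v.1 - red_dot v w * u.1.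
  by rewrite /cross /red_dot; ring.
rewrite hu hv !mul0r subrr in e1 e2.
case: w e1 e2 {hu hv} => [w1 w2] /= /eqP e1 /eqP e2.
rewrite !mulf_eq0 (negbTE c0) /= in e1 e2.
by rewrite (eqP e1) (eqP e2).
Qed.

Lemma point_ext (F : fieldType) (P Q : point F) :
  P.1 = Q.1 -> P.2 = Q.2 -> P = Q.
Proof. by case: P Q => [p1 p2] [q1 q2] /= -> ->. Qed.

Section EulerLine.

Variables (F : fieldType) (A B C : point F).
Hypothesis (two_neq0 : 2%:R != 0 :> F) (hA : triangle A B C).

Lemma orthocenter_circumcenter (O K : point F) :
  red_orthocenter A B C O -> red_circumcenter A B C K ->
  O + 2%:R *: K = A + B + C.
Proof.
move=> [_ /on_red_altitude_dot oB /on_red_altitude_dot oC].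
move=> [/on_red_altitude_dot kC _ /on_red_altitude_dot kB].
apply/eqP; rewrite -subr_eq0; apply/eqP.
apply: (red_dot_nondegenerate (triangle_cross hA)).
  (* Here [(O - C) + 2 (K - midpoint A B)] is [O + 2 K - (A + B + C)]. *)
  transitivity (red_dot (B - A) (O - C)
                + 2%:R * red_dot (B - A) (K - midpoint A B)).
    rewrite /red_dot /midpoint /= /GRing.scale /=; field; exact: two_neq0.
  by rewrite oC kC mulr0 addr0.
transitivity (- (red_dot (A - C) (O - B)
              + 2%:R * red_dot (A - C) (K - midpoint C A))).
  rewrite /red_dot /midpoint /= /GRing.scale /=; field; exact: two_neq0.
by rewrite oB kB mulr0 addr0 oppr0.
Qed.

Lemma nine_point_center_midpoint (O K N : point F) :
  red_orthocenter A B C O -> red_circumcenter A B C K ->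
  red_nine_point_center A B C N -> N = midpoint O K.
Proof.
move=> [_ /on_red_altitude_dot oB /on_red_altitude_dot oC].
move=> [/on_red_altitude_dot kC _ /on_red_altitude_dot kB].
move=> [/on_red_altitude_dot nC _ /on_red_altitude_dot nB].
apply/eqP; rewrite -subr_eq0; apply/eqP.
apply: (red_dot_nondegenerate (triangle_cross hA)).
  (* The medial side [midpoint C A - midpoint B C] is [- (B - A) / 2], whence the outer sign and the
     factor 2. *)
  transitivity (- (2%:R * red_dot (midpoint C A - midpoint B C)
                     (N - midpoint (midpoint B C) (midpoint C A))
     + (1 / 2%:R) * red_dot (B - A) (O - C)
     + (1 / 2%:R) * red_dot (B - A) (K - midpoint A B))).
    rewrite /red_dot /midpoint /= /GRing.scale /=; field; exact: two_neq0.
  by rewrite nC oC kC !mulr0 !addr0 oppr0.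
transitivity (2%:R * red_dot (midpoint B C - midpoint A B)
                   (N - midpoint (midpoint A B) (midpoint B C))
   + (1 / 2%:R) * red_dot (A - C) (O - B)
   + (1 / 2%:R) * red_dot (A - C) (K - midpoint C A)).
  rewrite /red_dot /midpoint /= /GRing.scale /=; field; exact: two_neq0.
by rewrite nB oB kB !mulr0 !addr0.
Qed.

(* Eliminating between two median equations leaves
   [cross (B - A) (C - A) = 3 cross (G - A) (A - B)], so a common point of the
   medians excludes characteristic three. *)
Lemma centroid_char_neq3 (G : point F) : centroid A B C G -> 3%:R != 0 :> F.
Proof.
move=> [/on_median_cross mA /on_median_cross mB _].
apply/eqP=> three0; case/eqP: (triangle_cross hA).
transitivity (2%:R * cross (midpoint C A - B) (G - B)
  - 2%:R * cross (midpoint B C - A) (G - A)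
  + 3%:R * cross (G - A) (A - B)).
  rewrite /cross /midpoint /= /GRing.scale /=; field; exact: two_neq0.
by rewrite mA mB three0 mul0r !mulr0 subrr addr0.
Qed.

(** Two median equations are solved for [G] by elimination. The doubled median directions
    [B + C - 2 A] and [A + C - 2 B] have cross product [3 cross (B - A) (C - A)], so [3 G] appears
    without dividing by three. *)
Lemma centroid_sum (G : point F) : centroid A B C G -> 3%:R *: G = A + B + C.
Proof.
move=> [/on_median_cross mA /on_median_cross mB _].
have c0 := triangle_cross hA.
apply: point_ext; apply: (mulfI c0); apply/eqP; rewrite -subr_eq0; apply/eqP.
  transitivity (2%:R * cross (midpoint B C - A) (G - A) * (A.1 + C.1 - 2%:R * B.1)
    - 2%:R * cross (midpoint C A - B) (G - B) * (B.1 + C.1 - 2%:R * A.1)).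
    rewrite /cross /midpoint /= /GRing.scale /=; field; exact: two_neq0.
  by rewrite mA mB mulr0 !mul0r subrr.
transitivity (2%:R * cross (midpoint B C - A) (G - A) * (A.2 + C.2 - 2%:R * B.2)
  - 2%:R * cross (midpoint C A - B) (G - B) * (B.2 + C.2 - 2%:R * A.2)).
  rewrite /cross /midpoint /= /GRing.scale /=; field; exact: two_neq0.
by rewrite mA mB mulr0 !mul0r subrr.
Qed.

End EulerLine.

(** Coincident points are allowed, since [Or] and [Cr] are not known to be distinct; a vertical line
    then serves. *)
Lemma exists_line_through (F : fieldType) (P Q : point F) :
  exists l : line F, line_through P Q l.
Proof.
case: (eqVneq P Q) => [<-|/eqP PQ].
  have n0 : ((1 : F) != 0) || ((0 : F) != 0) by rewrite oner_neq0.
  by exists (@Line F _ _ (- P.1) n0); split; rewrite /on_line /=; ring.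
by have [l hl _] := cross_collinear PQ; exists l.
Qed.

Lemma on_line_affine (F : fieldType) (P Q : point F) (l : line F) (a b : F) :
  line_through P Q l -> a + b = 1 -> on_line (a *: P + b *: Q) l.
Proof.
rewrite /line_through /on_line => -[hP hQ] ab.
transitivity (a * (la l * P.1 + lb l * P.2 + lc l)
  + b * (la l * Q.1 + lb l * Q.2 + lc l) + (1 - (a + b)) * lc l).
  by rewrite /= /GRing.scale /=; ring.
by rewrite hP hQ ab subrr mul0r !mulr0 !addr0.
Qed.

Theorem theorem19 (F : fieldType) (char_neq2 : 2%N \notin [pchar F])
    (A1 A2 A3 Or Cr Nr G : point F)
    (hA : triangle A1 A2 A3)
    (hO : red_orthocenter A1 A2 A3 Or)
    (hC : red_circumcenter A1 A2 A3 Cr)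
    (hN : red_nine_point_center A1 A2 A3 Nr)
    (hG : centroid A1 A2 A3 G) :
  [/\ exists l : line F,
        [/\ on_line Or l, on_line Nr l, on_line G l & on_line Cr l],
      Nr = midpoint Or Cr,
      G = (1 / 3) *: Or + (2 / 3) *: Cr
    & G = (1 / 3) *: Cr + (2 / 3) *: Nr].
Proof.
have two0 : 2%:R != 0 :> F by move: char_neq2; rewrite inE.
have three0 := centroid_char_neq3 two0 hA hG.
have eN := nine_point_center_midpoint two0 hA hO hC hN.
have eG : G = (1 / 3) *: Or + (2 / 3) *: Cr.
  apply: (scalerI three0).
  rewrite (centroid_sum two0 hA hG) -(orthocenter_circumcenter two0 hA hO hC).
  by apply: point_ext; rewrite /= /GRing.scale /=; field.
have eG' : G = (1 / 3) *: Cr + (2 / 3) *: Nr.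
  rewrite eG eN; apply: point_ext; rewrite /midpoint /= /GRing.scale /=;
    by field; rewrite two0 three0.
split=> //.
have [l hl] := exists_line_through Or Cr.
have [lO lC] := hl.
(* [Nr] and [G] are affine combinations of [Or] and [Cr], so any line through these two contains
   them. *)
exists l; split=> //.
  by rewrite eN; apply: on_line_affine hl _; field.
by rewrite eG; apply: on_line_affine hl _; field.
Qed.
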